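(* Let $W$ be a finite Coxeter group, realized as a finite real reflection group, and let $\gamma$ be a Coxeter element of $W$. Then the poset $\mathrm{NC}_W = \mathrm{NC}_W(\gamma)$ is EL-shellable.
   Context: A finite real reflection group $W$ of rank $\ell$ acts faithfully by orthogonal transformations on an $\ell$-dimensional Euclidean space $V$ and is generated by orthogonal reflections; $\Phi$ is a corresponding root system, i.e. a finite $W$-invariant set consisting of one pair $\{\alpha,-\alpha\}$ of nonzero vectors for each reflection in $W$, orthogonal to its reflecting hyperplane. $T$ is the set of all reflections in $W$. A Coxeter element of $W$ is the product, in an arbitrary order, of the simple reflections for any choice of simple system for $\Phi$. For $w\in W$, $l_T(w)$ is the smallest $k$ such that $w$ is a product of $k$ elements of $T$. The partial order $\preceq$ on $W$ is: $u\preceq v$ if and only if $l_T(u)+l_T(u^{-1}v)=l_T(v)$. It makes $W$ a graded poset with minimum $1$ and rank function $l_T$. $\mathrm{NC}_W(w)$ denotes the interval $[1,w]$ in $(W,\preceq)$. All Coxeter elements are conjugate, so the isomorphism type of $\mathrm{NC}_W(\gamma)$ does not depend on the Coxeter element $\gamma$; this poset is denoted $\mathrm{NC}_W$. EL-shellability: let $P$ be a finite bounded graded poset and $\mathcal{E}(P)$ its set of covering relations. An edge labeling of $P$ with a totally ordered label set $\Lambda$ is a map $\lambda:\mathcal{E}(P)\to\Lambda$. The label of an unrefinable chain $x_0<x_1<\cdots<x_r$ is $(\lambda(x_0,x_1),\dots,\lambda(x_{r-1},x_r))$; the chain is rising if the entries of its label strictly increase. Chains of the same length are compared by the lexicographic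 order on their labels. $\lambda$ is an EL-labeling if for every non-singleton interval $[u,v]$ of $P$: (i) there is a unique rising maximal chain in $[u,v]$, and (ii) this chain is lexicographically smallest among all maximal chains in $[u,v]$. $P$ is EL-shellable if it has an EL-labeling for some totally ordered label set $\Lambda$. *)

(* Defs.v *)
From HB Require Import structures.
From mathcomp Require Import all_boot all_order all_algebra all_fingroup all_character.
From mathcomp Require Import boolp reals.

Set Implicit Arguments.
Unset Strict Implicit.
Unset Printing Implicit Defensive.

Import Order.TTheory GRing.Theory Num.Theory.

Section ELShellability.
Local Open Scope order_scope.
Context {d : Order.disp_t} (P : finTBPOrderType d).
Implicit Types (x y u v : P) (s : seq P).

Definition covers x y : bool := (x < y) && [forall z, ~~ (x < z < y)].

(* u :: s is an unrefinable chain from u to v, i.e. a maximal chain of the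
   interval [u, v]. *)
Definition max_chain u v s : bool := path covers u s && (last u s == v).

Definition graded : Prop :=
  forall s s', max_chain \bot \top s -> max_chain \bot \top s' ->
  size s = size s'.

(* An edge labeling is a total function P -> P -> L; only its values on
   covering pairs are ever used. *)
Definition chain_label (L : Type) (lam : P -> P -> L) u s : seq L :=
  pairmap lam u s.

Definition rising d' (L : orderType d') (lam : P -> P -> L) u s : bool :=
  sorted <%O (chain_label lam u s).

(* seqlexi compares sequences lexicographically. *)
Definition EL_labeling d' (L : orderType d') (lam : P -> P -> L) : Prop :=
  forall u v, u < v ->
  exists s, [/\ max_chain u v s /\ rising lam u s,
    forall s', max_chain u v s' -> rising lam u s' -> s' = s &
    forall s', max_chain u v s' ->
      (chain_label lam u s : seqlexi L) <= chain_label lam u s'].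

(* EL-shellability is a property of graded posets, whence the first
   conjunct. *)
Definition EL_shellable : Prop :=
  graded /\
  exists (d' : Order.disp_t) (L : orderType d') (lam : P -> P -> L),
    EL_labeling lam.

End ELShellability.

Arguments EL_shellable {d} P.
Arguments graded {d} P.

Section Reflections.
Local Open Scope ring_scope.
Context {R : realType} {l : nat}.

Definition dotv (u v : 'rV[R]_l) : R := (u *m v^T) 0 0.

(* Matrix, acting on row vectors from the right, of the orthogonal reflection
   v |-> v - 2 (v, a) / (a, a) a. *)
Definition refl_mx (a : 'rV[R]_l) : 'M[R]_l :=
  1%:M - (2 / dotv a a) *: (a^T *m a).

Definition reflections (gT : finGroupType)
    (rho : mx_representation R [set: gT] l) : {set gT} :=
  [set t | `[< exists2 a : 'rV[R]_l, a != 0 & rho t = refl_mx a >]].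

End Reflections.

(* A finite group with a faithful orthogonal action on the Euclidean space
   R^l, generated by the elements that act as reflections. *)
Record reflection_group (R : realType) (l : nat) := ReflectionGroup {
  rg_group :> finGroupType;
  rg_rep : mx_representation R [set: rg_group] l;
  rg_faithful : mx_faithful rg_rep;
  rg_orthogonal : forall (g : rg_group) (u v : 'rV[R]_l),
    dotv (u *m rg_rep g)%R (v *m rg_rep g)%R = dotv u v;
  rg_generated : <<reflections rg_rep>>%g = [set: rg_group]
}.

Section RootSystems.
Local Open Scope ring_scope.
Context {R : realType} {l : nat} (W : reflection_group R l).
Implicit Types (Phi Delta : seq 'rV[R]_l).

Definition rg_refl : {set W} := reflections (rg_rep W).

(* A finite set of vectors is given by a sequence; only membership matters. *)
Record root_system Phi : Prop := RootSystem {
  rs_neq0 : forall a, a \in Phi -> a != 0;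
  rs_invariant : forall (g : W) a, a \in Phi -> a *m rg_rep W g \in Phi;
  rs_reflection : forall a, a \in Phi ->
    exists2 t : W, t \in rg_refl & rg_rep W t = refl_mx a;
  rs_pair : forall t : W, t \in rg_refl ->
    exists a, forall b,
      (b \in Phi) && (rg_rep W t == refl_mx b) = (b == a) || (b == - a)
}.

Record simple_system Phi Delta : Prop := SimpleSystem {
  ss_sub : {subset Delta <= Phi};
  ss_basis : basis_of <<Phi>>%VS Delta;
  ss_sign : forall a, a \in Phi ->
    (forall i, 0 <= coord (in_tuple Delta) i a) \/
    (forall i, coord (in_tuple Delta) i a <= 0)
}.

(* Delta is a sequence, so its ordering is the (arbitrary) order of the
   factors of the product. *)
Definition coxeter_element Phi (w : W) : Prop :=
  exists (Delta : seq 'rV[R]_l) (ts : seq W),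
    [/\ simple_system Phi Delta,
        [seq rg_rep W t | t <- ts] = [seq refl_mx a | a <- Delta] &
        w = (\prod_(t <- ts) t)%g].

End RootSystems.

Section AbsoluteLength.
Context {R : realType} {l : nat} (W : reflection_group R l).
Implicit Types u v w : W.
Local Open Scope group_scope.

(* rg_refl W ^+ k is the set of products of k reflections. *)
Lemma refl_products w : exists k, w \in rg_refl W ^+ k.
Proof.
have: w \in <<rg_refl W>> by rewrite rg_generated inE.
case/gen_prodgP=> k [c cT ->]; exists k.
elim: k c cT => [|k IHk] c cT; first by rewrite big_ord0 set11.
by rewrite big_ord_recl expgS mem_mulg // IHk.
Qed.

Definition lT w : nat := ex_minn (refl_products w).

Lemma lT1 : lT 1 = 0.
Proof.
by rewrite /lT; case: ex_minnP => m _ /(_ 0); rewrite expg0 set11 leqn0 =>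
  /(_ isT)/eqP.
Qed.

Lemma lT0 w : lT w = 0 -> w = 1.
Proof.
by rewrite /lT; case: ex_minnP => m + _ m0; rewrite m0 expg0 => /set1P.
Qed.

Lemma lTM u v : lT (u * v) <= lT u + lT v.
Proof.
rewrite {2 3}/lT; case: ex_minnP => i ui _; case: ex_minnP => j vj _.
rewrite /lT; case: ex_minnP => m _; apply.
by rewrite expgD mem_mulg.
Qed.

Definition abs_le u v : bool := lT u + lT (u^-1 * v) == lT v.

Lemma abs_le_refl : reflexive abs_le.
Proof. by move=> u; rewrite /abs_le mulVg lT1 addn0. Qed.

Lemma abs_le_anti : antisymmetric abs_le.
Proof.
move=> u v /andP[/eqP uv /eqP vu].
have /lT0 e : lT (u^-1 * v) = 0.
  by move: vu; rewrite -uv -[RHS]addn0 -addnA => /addnI/eqP;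
     rewrite addn_eq0 => /andP[/eqP].
by rewrite -[v](mulKVg u) e mulg1.
Qed.

Lemma abs_le_trans : transitive abs_le.
Proof.
move=> v u w /eqP uv /eqP vw; rewrite /abs_le eqn_leq; apply/andP; split.
  rewrite -vw -uv -addnA leq_add2l.
  by rewrite -[w in X in X <= _](mulKVg v) mulgA lTM.
by rewrite -[w in X in X <= _](mulKVg u) lTM.
Qed.

End AbsoluteLength.

(* Alias of W carrying the partial order of the absolute length. *)
Definition abs_poset {R : realType} {l : nat} (W : reflection_group R l) : Type
  := W.

Fact abs_display : Order.disp_t. Proof. exact: Order.Disp tt tt. Qed.

HB.instance Definition _ (R : realType) l (W : reflection_group R l) :=
  FinGroup.on (abs_poset W).
HB.instance Definition _ (R : realType) l (W : reflection_group R l) :=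
  Order.Le_isPOrder.Build abs_display (abs_poset W)
    (@abs_le_refl R l W) (@abs_le_anti R l W) (@abs_le_trans R l W).

Section NC.
Local Open Scope order_scope.
Context {R : realType} {l : nat} (W : reflection_group R l).

Lemma abs_le1 (w : abs_poset W) : (1%g : abs_poset W) <= w.
Proof. by rewrite /Order.le /= /abs_le lT1 invg1 mul1g. Qed.

Definition NC (w : abs_poset W) : Type :=
  {u : abs_poset W | u \in `[1%g : abs_poset W, w]}.

Context (w : abs_poset W).
HB.instance Definition _ := SubFinite.on (NC w).
HB.instance Definition _ :=
  [SubChoice_isSubPOrder of NC w by <: with abs_display].

Fact NC_bot_subproof : (1%g : abs_poset W) \in `[1%g : abs_poset W, w].
Proof. by rewrite in_itv /= lexx abs_le1. Qed.
Fact NC_top_subproof : w \in `[1%g : abs_poset W, w].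
Proof. by rewrite in_itv /= lexx abs_le1. Qed.

Definition NC_bot : NC w := exist _ (1%g : abs_poset W) NC_bot_subproof.
Definition NC_top : NC w := exist _ w NC_top_subproof.

Fact NC_le0x (u : NC w) : NC_bot <= u.
Proof. by rewrite leEsub abs_le1. Qed.
Fact NC_lex1 (u : NC w) : u <= NC_top.
Proof. by rewrite leEsub; have:= valP u; rewrite in_itv => /andP[]. Qed.

HB.instance Definition _ := Order.hasBottom.Build abs_display (NC w) NC_le0x.
HB.instance Definition _ := Order.hasTop.Build abs_display (NC w) NC_lex1.
End NC.

Arguments NC {R l} W w.

(* Main.v *)
Require Import Defs.
From mathcomp Require Import all_boot all_order all_algebra all_fingroup all_character.
From mathcomp Require Import boolp reals.
From mathcomp Require Import ring lra zify.

(** Write [G] for the matrix of the Coxeter element [t_1 ... t_l] and let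
    [chi u v = (v (1 - G)^-1, u)], so that [chi u v + chi v u = (u, v)].  For
    any factorization of the Coxeter element into [l] reflections with roots
    [a_1, ..., a_l], the [a_i] form a basis and [chi a_i a_j = 0] for [i < j].

    Apply [t_1, t_2, ..., t_l, t_1, ...] successively to a positive root and
    record the first time it becomes negative.  This time is finite and
    determines the root, and it orders the positive roots so that [a < b]
    implies [chi a b >= 0 >= chi b a].  Label [u < v] by the rank of the
    positive root of [u^-1 v].

    The greedy chain, which always takes the smallest available label, is
    rising: a descent [t t'] could be replaced by [t' (t'^-1 t t')], which starts
    with a smaller label.  Two rising chains of an interval start with the same
    label: if a chain starts with a root [a] smaller than all roots [b_i] of a
    rising chain, then [chi b_i b_j = 0 >= chi b_j b_i] for [i < j] and
    [chi a b_i >= 0] force [a] to be a nonnegative combination of the [b_i], so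
    that [chi a a <= 0] because [chi b_i a <= 0], a contradiction. *)

Set Implicit Arguments.
Unset Strict Implicit.
Unset Printing Implicit Defensive.

Import Order.TTheory GRing.Theory Num.Theory.

(** * The inner product and reflections on row vectors *)

Section EuclideanSpace.
Local Open Scope ring_scope.
Context {R : realType} {l : nat}.
Implicit Types (a b u v x y : 'rV[R]_l) (s p q : seq 'rV[R]_l) (G : 'M[R]_l).

Lemma dotvC u v : dotv u v = dotv v u.
Proof. by rewrite /dotv -[u in LHS]trmxK -trmx_mul mxE. Qed.

Lemma dotvDl u v x : dotv (u + v) x = dotv u x + dotv v x.
Proof. by rewrite /dotv mulmxDl mxE. Qed.

Lemma dotvZl (c : R) u v : dotv (c *: u) v = c * dotv u v.
Proof. by rewrite /dotv -scalemxAl mxE. Qed.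

Lemma dotvNl u v : dotv (- u) v = - dotv u v.
Proof. by rewrite -scaleN1r dotvZl mulN1r. Qed.

Lemma dotvDr x u v : dotv x (u + v) = dotv x u + dotv x v.
Proof. by rewrite !(dotvC x) dotvDl. Qed.

Lemma dotvZr (c : R) u v : dotv u (c *: v) = c * dotv u v.
Proof. by rewrite !(dotvC u) dotvZl. Qed.

Lemma dotvNr u v : dotv u (- v) = - dotv u v.
Proof. by rewrite !(dotvC u) dotvNl. Qed.

Definition dotvE := (dotvDl, dotvDr, dotvNl, dotvNr, dotvZl, dotvZr).

Lemma dotv_gt0 u : u != 0 -> 0 < dotv u u.
Proof.
move=> u0; rewrite /dotv mxE.
have ge0 i : true -> 0 <= u 0 i * u^T i 0 by rewrite mxE -expr2 sqr_ge0.
rewrite lt_def sumr_ge0 // andbT psumr_eq0 //.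
apply: contraNN u0 => /allP u0; apply/eqP/rowP => i; rewrite mxE.
by have := u0 i (mem_index_enum i); rewrite mxE -expr2 sqrf_eq0 => /eqP.
Qed.

Lemma dotv_neq0 u : u != 0 -> dotv u u != 0.
Proof. by move=> /dotv_gt0/lt0r_neq0. Qed.

Lemma mul_refl_mx x a : x *m refl_mx a = x - (2 * dotv x a / dotv a a) *: a.
Proof.
rewrite /refl_mx mulmxBr mulmx1 -scalemxAr mulmxA [x *m _]mx11_scalar.
by rewrite mul_scalar_mx scalerA mulrAC.
Qed.

Lemma refl_mx_orthogonal a : a != 0 ->
  forall u v, dotv (u *m refl_mx a) (v *m refl_mx a) = dotv u v.
Proof.
move=> /dotv_neq0 a0 u v; rewrite !mul_refl_mx !dotvE (dotvC a v).
by field.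
Qed.

Lemma refl_mxK a : a != 0 -> refl_mx a *m refl_mx a = 1%:M.
Proof.
move=> /dotv_neq0 a0; apply/row_matrixP => i; rewrite rowE [RHS]rowE mulmxA mulmx1.
set x := delta_mx _ _; rewrite !mul_refl_mx.
rewrite !dotvE -addrA -opprD -scalerDl.
set c := (X in X *: a); rewrite (_ : c = 0) ?scale0r ?subr0 //.
by rewrite /c; field.
Qed.

Lemma refl_mx_conj G a : (forall u v, dotv (u *m G) (v *m G) = dotv u v) ->
  refl_mx a *m G = G *m refl_mx (a *m G).
Proof.
move=> oG; apply/row_matrixP => i; rewrite rowE [RHS]rowE !mulmxA.
by rewrite !mul_refl_mx !oG mulmxBl -scalemxAl.
Qed.

Lemma refl_mx_scale (c : R) a : c != 0 -> refl_mx (c *: a) = refl_mx a.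
Proof.
move=> c0; rewrite /refl_mx !dotvE [(c *: a)^T]linearZ /= -scalemxAl -scalemxAr !scalerA.
congr (_ - _ *: _).
have [a0|a0] := eqVneq (dotv a a) 0; first by rewrite a0 !(mulr0, invr0, mul0r).
by field; rewrite a0 c0.
Qed.

Lemma mul_refl_mx_self a : a != 0 -> a *m refl_mx a = - a.
Proof.
move=> /dotv_neq0 a0; rewrite mul_refl_mx -mulrA divff // mulr1.
by rewrite -{1}[a]scale1r -scalerBl (_ : 1 - 2 = -1) ?scaleN1r //; ring.
Qed.

(** * Products of reflections and the spans of their roots *)

Definition refl_prod s : 'M[R]_l := foldr (fun a G => refl_mx a *m G) 1%:M s.

Lemma refl_prod_cat p q : refl_prod (p ++ q) = refl_prod p *m refl_prod q.
Proof. by elim: p => [|a p IHp] /=; rewrite ?mul1mx // IHp mulmxA. Qed.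

Lemma refl_prod_orthogonal s : 0 \notin s ->
  forall u v, dotv (u *m refl_prod s) (v *m refl_prod s) = dotv u v.
Proof.
elim: s => [|a s IHs]; first by move=> _ u v; rewrite !mulmx1.
rewrite inE eq_sym => /norP[a0 s0] u v.
by rewrite /= !mulmxA IHs // refl_mx_orthogonal.
Qed.

Lemma sub_refl_prod_span s x : x - x *m refl_prod s \in <<s>>%VS.
Proof.
elim: s x => [|a s IHs] x; first by rewrite mulmx1 subrr mem0v.
rewrite /= mulmxA -[X in X - _](subrK (x *m refl_mx a)) -addrA span_cons.
apply: memv_add; last exact: IHs.
by rewrite mul_refl_mx opprB addrCA subrr addr0 memvZ ?memv_line.
Qed.

Lemma free_cons_neq0 a s : free (a :: s) -> a != 0.
Proof. by rewrite free_cons => /andP[+ _]; apply: contraNneq => ->; rewrite mem0v. Qed.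

(** The factor [refl_prod s] moves a vector only by elements of [<<s>>], so the hypothesis puts
    [x - x *m refl_mx a], a multiple of [a], into [<<s>>]; freeness makes it vanish. *)
Lemma free_refl_prod_ortho a s x : free (a :: s) ->
  x - x *m refl_prod (a :: s) \in <<s>>%VS ->
  dotv x a = 0 /\ x *m refl_prod (a :: s) = x *m refl_prod s.
Proof.
move=> fas; have a0 := dotv_neq0 (free_cons_neq0 fas).
move: fas; rewrite free_cons => /andP[aNs _] xs.
suff xa : dotv x a = 0.
  by rewrite /= mulmxA mul_refl_mx xa mulr0 mul0r scale0r subr0.
apply: contraNeq aNs => xa.
have : x - x *m refl_mx a \in <<s>>%VS.
  rewrite -[X in X \in _](addrK (x *m refl_mx a - x *m refl_mx a *m refl_prod s)).
  by rewrite addrA subrK rpredB //= ?sub_refl_prod_span // -mulmxA.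
rewrite mul_refl_mx opprB addrCA subrr addr0 rpredZeq.
by rewrite !mulf_eq0 invr_eq0 pnatr_eq0 (negPf xa) (negPf a0).
Qed.

Lemma free_refl_prod_fixed s x : free s -> x *m refl_prod s = x ->
  forall a, a \in s -> dotv x a = 0.
Proof.
elim: s => // a s IHs fas xs b; have := fas; rewrite free_cons => /andP[_ fs].
have [|xa xas] := free_refl_prod_ortho fas (x := x).
  by rewrite xs subrr mem0v.
by rewrite inE => /orP[/eqP-> //|]; apply: IHs; rewrite // -xas.
Qed.

(** [phi] stands for the inverse of [1 - refl_prod s], but it is constrained on [s] only: by
    [free_refl_prod_ortho] the head reflection acts trivially on [phi b] for [b] in the tail, so the
    same [phi] serves the shorter product in the induction. *)
Lemma free_refl_prod_triangular s (phi : 'rV[R]_l -> 'rV[R]_l) : free s ->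
  (forall b, b \in s -> phi b - phi b *m refl_prod s = b) ->
  pairwise (fun a b => dotv (phi b) a == 0) s.
Proof.
elim: s => // a s IHs fas phiP; have := fas; rewrite free_cons => /andP[_ fs].
have ortho b : b \in s ->
    dotv (phi b) a = 0 /\ phi b *m refl_prod (a :: s) = phi b *m refl_prod s.
  move=> bs; apply: free_refl_prod_ortho => //.
  by rewrite phiP ?memv_span // inE bs orbT.
apply/andP; split; first by apply/allP => b /ortho[-> _].
by apply: IHs => // b bs; case: (ortho b bs) => _ <-; rewrite phiP // inE bs orbT.
Qed.

Lemma free_span_full s : free s -> size s = l -> <<s>>%VS = fullv.
Proof.
by move=> /eqP fs sl; apply/eqP; rewrite eqEdim subvf fs sl dimvf /dim /= mul1n.
Qed.

Lemma dotv_full s x : <<s>>%VS = fullv -> (forall a, a \in s -> dotv x a = 0) -> x = 0.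
Proof.
move=> sV xs; apply/eqP; case: (eqVneq x 0) => // /dotv_neq0.
have : x \in <<s>>%VS by rewrite sV memvf.
rewrite -[s]/(tval (in_tuple s)) => /coord_span {2}->.
rewrite (big_morph (dotv x) (dotvDr x) (_ : dotv x 0 = 0)); last first.
  by rewrite -(scale0r (0 : 'rV[R]_l)) dotvZr mul0r.
rewrite big1 ?eqxx // => i _; rewrite dotvZr xs ?mulr0 //.
exact: mem_nth.
Qed.

Lemma sub_refl_prod_unit s : free s -> size s = l -> 1%:M - refl_prod s \in unitmx.
Proof.
move=> fs sl; rewrite -row_free_unit -kermx_eq0; apply/rowV0P => x /sub_kermxP.
rewrite mulmxBr mulmx1 => /eqP; rewrite subr_eq0 => /eqP xs.
apply: (dotv_full (free_span_full fs sl)) => a sa.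
exact: (free_refl_prod_fixed fs).
Qed.

(** The image of [1 - refl_prod s] lies in [<<s>>]. This yields both the freeness of roots in a
    factorization of length [l] and the lower bound on the number of factors. *)
Lemma sub_refl_prod_unit_span s : 1%:M - refl_prod s \in unitmx -> <<s>>%VS = fullv.
Proof.
move=> u; apply/vspaceP => x; rewrite memvf -(mulmxKV u x) mulmxBr mulmx1.
exact: sub_refl_prod_span.
Qed.

(* The parametrization of the orthogonal map [G] by Wall's bilinear form. *)
Definition wall_form G u v : R := dotv (v *m invmx (1%:M - G)) u.

Lemma wall_formDl G u v x : wall_form G (u + v) x = wall_form G u x + wall_form G v x.
Proof. by rewrite /wall_form dotvDr. Qed.

Lemma wall_formZl G (c : R) u v : wall_form G (c *: u) v = c * wall_form G u v.
Proof. by rewrite /wall_form dotvZr. Qed.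

Lemma wall_formDr G u v x : wall_form G x (u + v) = wall_form G x u + wall_form G x v.
Proof. by rewrite /wall_form mulmxDl dotvDl. Qed.

Lemma wall_formZr G (c : R) u v : wall_form G u (c *: v) = c * wall_form G u v.
Proof. by rewrite /wall_form -scalemxAl dotvZl. Qed.

Lemma wall_form_sym G u v : 1%:M - G \in unitmx ->
  (forall x y, dotv (x *m G) (y *m G) = dotv x y) ->
  wall_form G u v + wall_form G v u = dotv u v.
Proof.
move=> uG oG; rewrite /wall_form.
move: (mulmxKV uG u) (mulmxKV uG v); move: (u *m _) (v *m _) => x y <- <-.
rewrite !mulmxBr !mulmx1 !dotvE oG (dotvC y x) (dotvC y).
by ring.
Qed.

Lemma wall_form_diag G u : 1%:M - G \in unitmx ->
  (forall x y, dotv (x *m G) (y *m G) = dotv x y) ->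
  wall_form G u u = dotv u u / 2.
Proof. by move=> uG oG; rewrite -(wall_form_sym u u uG oG); field. Qed.

(** Conjugation by [refl_mx a] moves the first factor of the product to its end. This drives the
    induction in [trajectory_order]. *)
Lemma wall_form_refl a s u v : a != 0 -> 1%:M - refl_prod (a :: s) \in unitmx ->
  1%:M - refl_prod (rcons s a) \in unitmx ->
  wall_form (refl_prod (rcons s a)) (u *m refl_mx a) (v *m refl_mx a) =
  wall_form (refl_prod (a :: s)) u v.
Proof.
move=> a0 us us'; rewrite /wall_form.
set y := v *m invmx (1%:M - refl_prod (a :: s)).
rewrite -(refl_mx_orthogonal a0 y); congr (dotv _ _).
have -> : v = y *m (1%:M - refl_prod (a :: s)) by rewrite mulmxKV.
rewrite (_ : _ *m refl_mx a = y *m refl_mx a *m (1%:M - refl_prod (rcons s a))).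
  by rewrite mulmxK.
rewrite -cats1 refl_prod_cat /= mulmx1.
move: (refl_mx a) (refl_prod s) => A P.
by rewrite !mulmxBr !mulmxBl !mulmx1 !mulmxA.
Qed.

Lemma wall_form_triangular G s : refl_prod s = G -> 1%:M - G \in unitmx -> size s = l ->
  pairwise (fun a b => wall_form G a b == 0) s.
Proof.
move=> sG uG sl.
apply: (@free_refl_prod_triangular _ (fun b => b *m invmx (1%:M - G))).
  by rewrite /free (sub_refl_prod_unit_span (s := s)) ?sG // sl dimvf /dim /= mul1n.
move=> b _; rewrite sG -{1}[_ *m invmx _]mulmx1 -mulmxBr mulmxKV //.
Qed.

Lemma span_ind s (P : 'rV[R]_l -> Prop) : P 0 ->
  (forall c a x, a \in s -> P x -> P (c *: a + x)) ->
  forall x, x \in <<s>>%VS -> P x.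
Proof.
move=> P0; elim: s => [|a s IHs] PD x; first by rewrite span_nil memv0 => /eqP->.
rewrite span_cons => /memv_addP[_ /vlineP[c ->] [y ys ->]].
apply: (PD); first exact: mem_head.
by apply: IHs ys => d b z bs; apply: (PD); rewrite inE bs orbT.
Qed.

Lemma wall_form_span_eq0l G s x y : (forall a, a \in s -> wall_form G a y = 0) ->
  x \in <<s>>%VS -> wall_form G x y = 0.
Proof.
move=> sy; apply: (span_ind (P := fun x => wall_form G x y = 0)).
  by rewrite -(scale0r 0) wall_formZl mul0r.
by move=> c a z /sy as0 z0; rewrite wall_formDl wall_formZl as0 mulr0 z0 addr0.
Qed.

Lemma wall_form_span_eq0r G s x y : (forall a, a \in s -> wall_form G y a = 0) ->
  x \in <<s>>%VS -> wall_form G y x = 0.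
Proof.
move=> sy; apply: (span_ind (P := fun x => wall_form G y x = 0)).
  by rewrite -(scale0r 0) wall_formZr mul0r.
by move=> c a z /sy as0 z0; rewrite wall_formDr wall_formZr as0 mulr0 z0 addr0.
Qed.

(** * Spans and cones of triangular families for a positive form *)

Section WallFormPositive.
Context (G : 'M[R]_l) (wall_gt0 : forall x, x != 0 -> 0 < wall_form G x x).
Notation chi := (wall_form G).

(** The vectors of [p] are removed from the left and those of [q] from the right: pairing [x] with
    the outermost vector kills every term but its own, and positivity makes its coefficient zero. *)
Lemma triangular_span p s q x : 0 \notin p ++ s ++ q ->
  pairwise (fun a b => chi a b == 0) (p ++ s ++ q) -> x \in <<p ++ s ++ q>>%VS ->
  (forall a, a \in p -> chi a x = 0) -> (forall a, a \in q -> chi x a = 0) ->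
  x \in <<s>>%VS.
Proof.
elim: p => [|a p IHp] /=.
  elim/last_ind: q => [|q a IHq]; first by rewrite cats0.
  rewrite -rcons_cat mem_rcons inE eq_sym => /norP[a0 sq0].
  rewrite pairwise_rcons => /andP[/allP sqa tri] xs _ xq.
  apply: IHq => // [|b bq]; last by rewrite xq // mem_rcons inE bq orbT.
  move: xs; rewrite (eq_span (mem_rcons _ _)) span_cons.
  move=> /memv_addP[_ /vlineP[c ->] [y ys xE]].
  have := xq a; rewrite mem_rcons mem_head xE wall_formDl wall_formZl => /(_ isT).
  rewrite (wall_form_span_eq0l _ ys) => [|b /sqa/eqP //].
  move=> /eqP; rewrite addr0 mulf_eq0 (gt_eqF (wall_gt0 a0)) orbF => /eqP->.
  by rewrite scale0r add0r.
rewrite inE eq_sym => /norP[a0 psq0] /andP[/allP psqa tri] xs xp xq.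
apply: IHp => // [|b bp]; last by rewrite xp // inE bp orbT.
move: xs; rewrite span_cons.
move=> /memv_addP[_ /vlineP[c ->] [y ys xE]].
have := xp a (mem_head _ _); rewrite xE wall_formDr wall_formZr.
rewrite (wall_form_span_eq0r _ ys) => [|b /psqa/eqP //].
move=> /eqP; rewrite addr0 mulf_eq0 (gt_eqF (wall_gt0 a0)) orbF => /eqP->.
by rewrite scale0r add0r.
Qed.

(* Triangularity gives, from the last vector of [s] backwards, that the
   coordinates of [y] are nonnegative. *)
Lemma triangular_cone_le0 s y v : 0 \notin s ->
  pairwise (fun a b => (chi a b == 0) && (chi b a <= 0)) s -> y \in <<s>>%VS ->
  (forall a, a \in s -> 0 <= chi y a) -> (forall a, a \in s -> chi a v <= 0) ->
  chi y v <= 0.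
Proof.
elim/last_ind: s y => [|s a IHs] y.
  rewrite span_nil memv0 => _ _ /eqP-> _ _.
  by rewrite -(scale0r 0) wall_formZl mul0r.
rewrite mem_rcons inE eq_sym => /norP[a0 s0].
rewrite pairwise_rcons => /andP[/allP sa tri].
rewrite (eq_span (mem_rcons _ _)) span_cons.
move=> /memv_addP[_ /vlineP[c ->] [z zs ->]] ys sv.
have c0 : 0 <= c.
  have := ys a; rewrite mem_rcons mem_head wall_formDl wall_formZl => /(_ isT).
  rewrite (wall_form_span_eq0l _ zs) => [|b /sa/andP[/eqP]//].
  by rewrite addr0 pmulr_lge0 // wall_gt0.
have av : chi a v <= 0 by rewrite sv // mem_rcons mem_head.
rewrite wall_formDl wall_formZl; have : chi z v <= 0.
  (* Removing [c *: a] keeps the pairings with [s] nonnegative, since [c >= 0] and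
     [chi a b <= 0]. *)
  apply: IHs => // b bs; last by rewrite sv // mem_rcons inE bs orbT.
  have := ys b; rewrite mem_rcons inE bs orbT wall_formDl wall_formZl => /(_ isT).
  by have /sa/andP[_ ab] := bs; nra.
by nra.
Qed.

End WallFormPositive.
End EuclideanSpace.

(** * Simple systems and positive roots *)

Section ReflectionOrder.
Local Open Scope ring_scope.
Context {R : realType} {l : nat} (W : reflection_group R l).
Context (Phi Delta : seq 'rV[R]_l).
Hypotheses (hPhi : root_system W Phi) (hDelta : simple_system Phi Delta).
Hypothesis hrank : (\dim <<Phi>>)%VS = l.
Implicit Types (a b d x y : 'rV[R]_l) (D : seq 'rV[R]_l).

Definition positive x := [forall i, 0 <= coord (in_tuple Delta) i x].

Lemma simple_free : free Delta.
Proof. by have := ss_basis hDelta; rewrite basisEfree => /and3P[]. Qed.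

Lemma simple_size : size Delta = l.
Proof.
apply: etrans hrank; rewrite -(span_basis (ss_basis hDelta)).
exact/esym/eqP/simple_free.
Qed.

Lemma simple_coordE x : x = \sum_i coord (in_tuple Delta) i x *: Delta`_i.
Proof.
by apply: coord_span; rewrite (free_span_full simple_free simple_size) memvf.
Qed.

Lemma coord_simple (i j : 'I_(size Delta)) :
  coord (in_tuple Delta) i Delta`_j = (j == i)%:R.
Proof. exact: (coord_free j i (X := in_tuple Delta) simple_free). Qed.

Lemma positive_opp x : positive x -> positive (- x) -> x = 0.
Proof.
move=> /forallP xP /forallP xN; rewrite [x]simple_coordE big1 // => i _.
have := xN i; rewrite linearN oppr_ge0 => xi.
by rewrite (_ : coord _ _ _ = 0) ?scale0r //; apply/eqP; rewrite eq_le xi xP.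
Qed.

Lemma positive_simple d : d \in Delta -> positive d.
Proof.
move=> dD; apply/forallP => i; rewrite -(nth_index 0 dD).
have i_lt : (index d Delta < size Delta)%N by rewrite index_mem.
by rewrite (coord_simple i (Ordinal i_lt)) ler0n.
Qed.

Lemma root_sign a : a \in Phi -> positive a \/ positive (- a).
Proof.
move=> /(ss_sign hDelta)[aP|aN]; [left | right]; apply/forallP; first exact: aP.
by move=> i; rewrite linearN oppr_ge0 aN.
Qed.

(** Proportional roots define the same reflection, hence belong to the same pair in [rs_pair]. *)
Lemma reduced_root (c : R) a : a \in Phi -> c *: a \in Phi -> c *: a = a \/ c *: a = - a.
Proof.
move=> aP caP; have ca0 := rs_neq0 hPhi caP.
have c0 : c != 0 by apply: contraNneq ca0 => ->; rewrite scale0r.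
have [t tT ta] := rs_reflection hPhi aP.
have [e eP] := rs_pair hPhi tT.
have := eP a; rewrite aP ta eqxx => /esym/orP.
have := eP (c *: a); rewrite caP ta refl_mx_scale // eqxx => /esym/orP.
by case=> /eqP-> [] /eqP->; rewrite ?opprK; auto.
Qed.

Lemma root_reflect d a : d \in Delta -> a \in Phi -> a *m refl_mx d \in Phi.
Proof.
move=> /(ss_sub hDelta)/(rs_reflection hPhi)[t _ <-].
exact: (rs_invariant hPhi).
Qed.

Lemma positive_reflect d a : d \in Delta -> a \in Phi -> positive a -> a != d ->
  positive (a *m refl_mx d).
Proof.
move=> dD aP apos; apply: contraNT => rneg.
have [|/forallP rN] := root_sign (root_reflect dD aP); first by rewrite (negPf rneg).
have i_lt : (index d Delta < size Delta)%N by rewrite index_mem.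
pose i := Ordinal i_lt; have iE : Delta`_i = d by rewrite nth_index.
(* The reflection changes only the coordinate at [d]; the others are nonnegative before it and
   nonpositive after it, hence zero. *)
have aE : a = coord (in_tuple Delta) i a *: d.
  rewrite [LHS]simple_coordE (bigD1 i) //= iE big1 ?addr0 // => j ji.
  rewrite (_ : coord _ _ _ = 0) ?scale0r //; apply/eqP; rewrite eq_le.
  rewrite (forallP apos) andbT -oppr_ge0 -linearN.
  have := rN j; rewrite mul_refl_mx opprB linearB linearZ /=.
  by rewrite -iE coord_simple eq_sym (negPf ji) mulr0 sub0r linearN.
have := aP; rewrite {1}aE => /(reduced_root (ss_sub hDelta dD)).
rewrite -aE => -[->//|aN].
have := rs_neq0 hPhi aP; rewrite [a]positive_opp ?eqxx // aN opprK.
exact: positive_simple.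
Qed.

Lemma simple_unit D : perm_eq D Delta -> 1%:M - refl_prod D \in unitmx.
Proof.
move=> DD; apply: sub_refl_prod_unit; last by rewrite (perm_size DD) simple_size.
by rewrite (perm_free DD) simple_free.
Qed.

Lemma simple_neq0 D : perm_eq D Delta -> 0 \notin D.
Proof.
move=> DD; rewrite (perm_mem DD); apply/negP.
by move=> /(ss_sub hDelta)/(rs_neq0 hPhi); rewrite eqxx.
Qed.

Lemma simple_wall_sym D a b : perm_eq D Delta ->
  wall_form (refl_prod D) a b + wall_form (refl_prod D) b a = dotv a b.
Proof.
move=> DD; apply: wall_form_sym (simple_unit DD) _.
exact: refl_prod_orthogonal (simple_neq0 DD).
Qed.

(* The first simple root [d] is first in the order: both values are, up to a
   positive factor, [d]-coordinates of positive roots. *)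
Lemma wall_form_simple d D b : perm_eq (d :: D) Delta ->
  positive b -> positive (b *m refl_mx d) ->
  (0 <= wall_form (refl_prod (d :: D)) d b) /\
  (wall_form (refl_prod (d :: D)) b d <= 0).
Proof.
move=> DD /forallP bpos /forallP rpos; have uD := simple_unit DD.
have dD : d \in Delta by rewrite -(perm_mem DD) mem_head.
have d0 : d != 0 by apply: (rs_neq0 hPhi); apply: (ss_sub hDelta).
have i_lt : (index d Delta < size Delta)%N by rewrite index_mem.
pose i := Ordinal i_lt; have iE : Delta`_i = d by rewrite nth_index.
have tri := wall_form_triangular erefl uD (etrans (perm_size DD) simple_size).
have/andP[/allP dtri _] := tri.
set chi := wall_form (refl_prod (d :: D)) in dtri *.
have chiZ c x y : chi x (c *: y) = c * chi x y by exact: wall_formZr.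
have chidd : chi d d = dotv d d / 2.
  exact: (wall_form_diag _ uD (refl_prod_orthogonal (simple_neq0 DD))).
(* Since [d] is the first factor, [chi d] vanishes on all other simple roots. *)
have chidb : chi d b = coord (in_tuple Delta) i b * chi d d.
  have chiD : {morph chi d : x y / x + y} by move=> x y; exact: wall_formDr.
  have chi0 : chi d 0 = 0 by rewrite -(scale0r 0) chiZ mul0r.
  rewrite {1}[b]simple_coordE (big_morph _ chiD chi0).
  rewrite (bigD1 i) //= iE chiZ big1 ?addr0 // => j ji.
  rewrite chiZ; suff /dtri/eqP-> : Delta`_j \in D by rewrite mulr0.
  have : Delta`_j \in d :: D by rewrite (perm_mem DD) mem_nth.
  rewrite inE -iE nth_uniq ?(free_uniq simple_free) //.
  by rewrite (inj_eq val_inj) (negPf ji).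
have dd := dotv_gt0 d0; have bi := bpos i; have ri := rpos i.
split; first by rewrite chidb chidd mulr_ge0 // divr_ge0 // ltW.
move: ri; rewrite mul_refl_mx linearB linearZ /=.
have -> : coord (in_tuple Delta) i d = 1 by rewrite -iE coord_simple eqxx.
(* The right-hand side is [- (d, d) / 2] times the coordinate at [d] of [b *m refl_mx d]. *)
have -> : chi b d = dotv b d - coord (in_tuple Delta) i b * (dotv d d / 2).
  by rewrite -(simple_wall_sym b d DD) -/chi chidb chidd addrK.
move: (coord _ _ _) (dotv d d) dd (dotv b d) => c D2 D2gt0 e.
rewrite mulr1 subr_ge0 ler_pdivrMr // => ri; lra.
Qed.

(** * Cyclic trajectories of roots and the resulting order *)

Lemma simple_nonempty a : a \in Phi -> ~ perm_eq [::] Delta.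
Proof.
move=> /(rs_neq0 hPhi)/eqP a0 /perm_size; rewrite /= => /esym D0; apply: a0.
by rewrite [a]simple_coordE big1 // => i _; exfalso; move: (size _) D0 i => n -> [].
Qed.

(** Rotating [D], rather than indexing modulo its size, lets inductions on [k] pass to the conjugate
    Coxeter element with the first factor moved to the end. The default [0] is met only for empty
    [D], which [simple_nonempty] excludes. *)
Fixpoint trajectory k D x :=
  if k is k'.+1 then trajectory k' (rot 1 D) (x *m refl_mx (head 0 D)) else x.

Lemma trajectory_cat k p q x :
  trajectory (size p + k) (p ++ q) x = trajectory k (q ++ p) (x *m refl_prod p).
Proof.
elim: p q x => [|a p IHp] q x; first by rewrite cats0 mulmx1.
by rewrite /= rot1_cons rcons_cat IHp cat_rcons mulmxA.
Qed.

(* A root leaving the positive cone at time [k.+1] is the current simple root. *)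
Lemma trajectory_exit_inj k D a b : perm_eq D Delta -> a \in Phi -> b \in Phi ->
  (forall j, (j <= k)%N -> positive (trajectory j D a)) ->
  (forall j, (j <= k)%N -> positive (trajectory j D b)) ->
  ~~ positive (trajectory k.+1 D a) -> ~~ positive (trajectory k.+1 D b) -> a = b.
Proof.
elim: k D a b => [|k IHk] [|d D] a b DD aP bP apos bpos aneg bneg.
- by have := simple_nonempty aP DD.
- have dD : d \in Delta by rewrite -(perm_mem DD) mem_head.
  have /eqP-> : a == d.
    by apply: contraNT aneg; apply: positive_reflect => //; apply: (apos 0%N).
  by apply/esym/eqP; apply: contraNT bneg; apply: positive_reflect => //;
     apply: (bpos 0%N).
- by have := simple_nonempty aP DD.
have dD : d \in Delta by rewrite -(perm_mem DD) mem_head.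
have d0 : d != 0 by apply: (rs_neq0 hPhi); apply: (ss_sub hDelta).
suff /(congr1 (mulmx^~ (refl_mx d))) : a *m refl_mx d = b *m refl_mx d.
  by rewrite -!mulmxA refl_mxK // !mulmx1.
apply: (IHk (rcons D d)).
- by rewrite perm_rcons.
- exact: root_reflect.
- exact: root_reflect.
- by move=> j jk; have := apos j.+1 jk; rewrite /= rot1_cons.
- by move=> j jk; have := bpos j.+1 jk; rewrite /= rot1_cons.
- by move: aneg; rewrite /= !rot1_cons.
- by move: bneg; rewrite /= !rot1_cons.
Qed.

(** If [a] leaves at the first reflection, it is the first simple root while [b] stays positive, and
    [wall_form_simple] applies. Otherwise both roots are reflected once, and [wall_form_refl]
    identifies the forms before and after. *)
Lemma trajectory_order k D a b : perm_eq D Delta -> a \in Phi -> b \in Phi ->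
  (forall j, (j <= k)%N -> positive (trajectory j D a)) ->
  ~~ positive (trajectory k.+1 D a) ->
  (forall j, (j <= k.+1)%N -> positive (trajectory j D b)) ->
  (0 <= wall_form (refl_prod D) a b) /\ (wall_form (refl_prod D) b a <= 0).
Proof.
elim: k D a b => [|k IHk] [|d D] a b DD aP bP apos aneg bpos.
- by have := simple_nonempty aP DD.
- have dD : d \in Delta by rewrite -(perm_mem DD) mem_head.
  have /eqP-> : a == d.
    by apply: contraNT aneg; apply: positive_reflect => //; apply: (apos 0%N).
  by apply: wall_form_simple => //; [apply: (bpos 0%N) | apply: (bpos 1%N)].
- by have := simple_nonempty aP DD.
have dD : d \in Delta by rewrite -(perm_mem DD) mem_head.
have d0 : d != 0 by apply: (rs_neq0 hPhi); apply: (ss_sub hDelta).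
have DD' : perm_eq (rcons D d) Delta by rewrite perm_rcons.
rewrite -2!(wall_form_refl _ _ d0 (simple_unit DD) (simple_unit DD')).
apply: IHk => //.
- exact: root_reflect.
- exact: root_reflect.
- by move=> j jk; have := apos j.+1 jk; rewrite /= rot1_cons.
- by move: aneg; rewrite /= !rot1_cons.
- by move=> j jk; have := bpos j.+1 jk; rewrite /= rot1_cons.
Qed.

(* Otherwise the orbit sum of [a] under the finite group generated by the
   Coxeter element would be a nonzero fixed vector. *)
Lemma trajectory_exit (g : W) a : rg_rep W g = refl_prod Delta -> a \in Phi ->
  exists k, ~~ positive (trajectory k Delta a).
Proof.
move=> gE aP; apply: contrapT => /forallNP allpos.
have pos k : positive (trajectory k Delta a) by apply/negPn/negP/allpos.
have trajE m : trajectory (m * size Delta) Delta a = a *m rg_rep W (g ^+ m)%g.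
  elim: m (a) => [|m IHm] x; first by rewrite expg0 repr_mx1 mulmx1.
  have := trajectory_cat (m * size Delta) Delta [::] x; rewrite cats0 -mulSn => ->.
  by rewrite IHm expgS repr_mxM ?inE // -gE mulmxA.
pose y := \sum_(m < #[g]%g) a *m rg_rep W (g ^+ m)%g.
have yg : y *m refl_prod Delta = y.
  rewrite /y mulmx_suml; case: #[g]%g (expg_order g) => [_|o go].
    by rewrite !big_ord0.
  (* Multiplication by [g] shifts the summands by one, and the last becomes the first because [g]
     has order [o.+1]. *)
  rewrite big_ord_recr [RHS]big_ord_recl addrC /= -gE -!mulmxA -!repr_mxM ?inE //.
  rewrite -expgSr go expg0; congr (_ + _); apply: eq_bigr => i _.
  by rewrite -mulmxA -repr_mxM ?inE // -expgSr.
have y0 : y = 0.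
  have uD := simple_unit (perm_refl Delta).
  by rewrite -(mulmxK uD y) mulmxBr mulmx1 yg subrr mul0mx.
have/eqP := rs_neq0 hPhi aP; apply; rewrite [a]simple_coordE big1 // => i _.
have ge0 (m : 'I_#[g]%g) : true ->
    0 <= coord (in_tuple Delta) i (a *m rg_rep W (g ^+ m)%g).
  by rewrite -trajE => _; apply: (forallP (pos _)).
(* A vanishing sum of nonnegative coordinates has only zero terms; the term of exponent [0] is the
   coordinate of [a] itself. *)
have /eqP := congr1 (coord (in_tuple Delta) i) y0.
rewrite linear0 linear_sum /= psumr_eq0 // => /allP/(_ (Ordinal (order_gt0 g))).
rewrite mem_index_enum /= expg0 repr_mx1 mulmx1 => /(_ isT)/eqP->.
by rewrite scale0r.
Qed.

Lemma root_order (g : W) : rg_rep W g = refl_prod Delta ->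
  exists rk : 'rV[R]_l -> nat, forall a b, a \in Phi -> b \in Phi ->
  positive a -> positive b ->
  (rk a = rk b -> a = b) /\
  ((rk a < rk b)%N -> 0 <= wall_form (rg_rep W g) a b /\ wall_form (rg_rep W g) b a <= 0).
Proof.
move=> gE.
(* The rank is the time just before the first exit, whence [k.+1]; off the positive roots the value
   [0] is arbitrary. *)
have exit_time a : exists k, a \in Phi -> positive a ->
    (forall j, (j <= k)%N -> positive (trajectory j Delta a)) /\
    ~~ positive (trajectory k.+1 Delta a).
  case: (boolP (a \in Phi)) => [aP|_]; last by exists 0%N.
  case: (boolP (positive a)) => [apos|_]; last by exists 0%N.
  case: (ex_minnP (trajectory_exit gE aP)) => -[|k] kneg kmin.
    by rewrite apos in kneg.
  exists k => _ _; split=> // j jk; apply: contraT => /kmin.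
  by rewrite ltnNge jk.
have [rk rkP] := choice exit_time; exists rk => a b aP bP apos bpos.
have [aj aneg] := rkP a aP apos; have [bj bneg] := rkP b bP bpos.
split=> [rkE|lt_rk].
  rewrite -rkE in bj bneg.
  exact: trajectory_exit_inj (perm_refl Delta) aP bP aj bj aneg bneg.
rewrite gE; apply: trajectory_order (perm_refl Delta) aP bP aj aneg _ => j jk.
by apply: bj; apply: leq_trans jk lt_rk.
Qed.

End ReflectionOrder.

(** * Reflections and reduced words for the absolute length *)

Section AbsoluteOrder.
Local Open Scope group_scope.
Context {R : realType} {l : nat} (W : reflection_group R l).
Implicit Types (t u v w : W) (ts : seq W).

Lemma rg_rep_inj : injective (rg_rep W).
Proof. by move=> u v; apply: (mx_faithful_inj (rg_faithful W)); rewrite inE. Qed.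

Lemma rg_repM u v : rg_rep W (u * v) = (rg_rep W u *m rg_rep W v)%R.
Proof. by rewrite repr_mxM ?inE. Qed.

Lemma rep_prod ts (D : seq 'rV[R]_l) :
  map (rg_rep W) ts = map refl_mx D -> rg_rep W (\prod_(t <- ts) t) = refl_prod D.
Proof.
elim: ts D => [|t ts IHts] [|d D] //=; first by rewrite big_nil repr_mx1.
by move=> [td /IHts tsE]; rewrite big_cons rg_repM td tsE.
Qed.

Lemma rep_prod_roots (rt : W -> 'rV[R]_l) ts :
  {in ts, forall t, rg_rep W t = refl_mx (rt t)} ->
  rg_rep W (\prod_(t <- ts) t) = refl_prod (map rt ts).
Proof. by move=> tsE; apply: rep_prod; rewrite -map_comp; apply/eq_in_map. Qed.

Lemma rg_reflP t :
  reflect (exists2 a : 'rV[R]_l, a != 0%R & rg_rep W t = refl_mx a) (t \in rg_refl W).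
Proof. by rewrite inE; apply: asboolP. Qed.

Lemma rg_refl_conj t w : t \in rg_refl W -> t ^ w \in rg_refl W.
Proof.
move=> /rg_reflP[a a0 tE]; apply/rg_reflP; exists (a *m rg_rep W w)%R.
  apply: contra_neq a0 => aw0.
  by rewrite -[a]mulmx1 -(repr_mx1 (rg_rep W)) -(mulgV w) rg_repM mulmxA aw0 mul0mx.
apply: (can_inj (mulKmx (repr_mx_unit (rg_rep W) (in_setT w)))).
by rewrite -refl_mx_conj; [rewrite -tE -!rg_repM -conjgC | exact: rg_orthogonal].
Qed.

Lemma rg_refl_neq1 : 1 \notin rg_refl W.
Proof.
apply/negP => /rg_reflP[a a0]; rewrite repr_mx1 => /(congr1 (mulmx a)).
rewrite mulmx1 mul_refl_mx_self // => /eqP; rewrite -addr_eq0 -mulr2n -scaler_nat.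
by rewrite scaler_eq0 pnatr_eq0 (negPf a0).
Qed.

Lemma rg_refl_sq t : t \in rg_refl W -> t * t = 1.
Proof.
move=> /rg_reflP[a a0 tE]; apply: rg_rep_inj.
by rewrite rg_repM tE refl_mxK // repr_mx1.
Qed.

Lemma lT_prod_le ts : all [in rg_refl W] ts -> lT (\prod_(t <- ts) t) <= size ts.
Proof.
move=> tsT; rewrite /lT; case: ex_minnP => m _; apply.
elim: ts tsT => [|t ts IHts]; first by rewrite big_nil expg0 set11.
by move=> /andP[tT /IHts]; rewrite big_cons expgS; apply: mem_mulg.
Qed.

Lemma reduced_word w : exists ts,
  [/\ all [in rg_refl W] ts, \prod_(t <- ts) t = w & size ts = lT w].
Proof.
rewrite /lT; case: ex_minnP => m + _; elim: m w => [|m IHm] w.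
  by rewrite expg0 => /set1P->; exists [::]; rewrite big_nil.
rewrite expgS => /mulsgP[t u tT /IHm[ts [tsT <- <-]] ->].
by exists (t :: ts); rewrite big_cons /= tT.
Qed.

Lemma lT_eq1 w : (lT w == 1%N) = (w \in rg_refl W).
Proof.
apply/eqP/idP => [w1|wT].
  have [ts [tsT wE]] := reduced_word w; rewrite {}w1 -{}wE.
  by case: ts tsT => [|t [|]] //=; rewrite andbT big_seq1.
have := @lT_prod_le [:: w]; rewrite /= wT big_seq1 => /(_ isT).
case: (lT w) (@lT0 _ _ W w) => [w0 _|[]//].
by have := rg_refl_neq1; rewrite -w0 // wT.
Qed.

Lemma lT_mul_le u v : lT v <= lT u + lT (u^-1 * v).
Proof. by rewrite -{1}[v](mulKVg u) lTM. Qed.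

End AbsoluteOrder.

(** * Reflection factorizations of the Coxeter element *)

Section CoxeterElement.
Local Open Scope ring_scope.
Context {R : realType} {l : nat} (W : reflection_group R l).
Context (Phi Delta : seq 'rV[R]_l) (gamma : W).
Hypotheses (hPhi : root_system W Phi) (hDelta : simple_system Phi Delta).
Hypotheses (hrank : (\dim <<Phi>>)%VS = l) (gammaE : rg_rep W gamma = refl_prod Delta).
Implicit Types (t u v w : W) (ts : seq W).

Lemma positive_root : exists rt : W -> 'rV[R]_l, forall t, t \in rg_refl W ->
  [/\ rt t \in Phi, positive Delta (rt t) & rg_rep W t = refl_mx (rt t)].
Proof.
suff /choice[rt rtP] : forall t, exists a, t \in rg_refl W ->
    [/\ a \in Phi, positive Delta a & rg_rep W t = refl_mx a] by exists rt.
move=> t; case: (boolP (t \in rg_refl W)) => [tT|_]; last by exists 0.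
have [a aE] := rs_pair hPhi tT.
have := aE a; rewrite eqxx /= => /andP[aP /eqP ta].
have := aE (- a); rewrite eqxx orbT => /andP[NaP /eqP tNa].
by have [apos|Napos] := root_sign hDelta aP; [exists a | exists (- a)].
Qed.

Lemma gamma_unit : 1%:M - rg_rep W gamma \in unitmx.
Proof. by rewrite gammaE (simple_unit hDelta hrank). Qed.

(** The simple reflections give a word of length [l]. Conversely, [1 - gamma] is invertible, so the
    roots of any factorization span the space and there are at least [l] of them. *)
Lemma lT_gamma : lT gamma = l.
Proof.
have [rt rtP] := positive_root.
have simple_refl d : d \in Delta -> exists2 t, t \in rg_refl W & rg_rep W t = refl_mx d.
  by move=> /(ss_sub hDelta)/(rs_reflection hPhi).
apply/eqP; rewrite eqn_leq; apply/andP; split.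
  have [ts [tsT tsE]] : exists ts, all [in rg_refl W] ts /\
      map (rg_rep W) ts = map (@refl_mx R l) Delta.
    elim: (Delta) simple_refl => [|d D IHD] DT; first by exists [::].
    have [t tT td] := DT d (mem_head _ _).
    have [|ts [tsT tsE]] := IHD.
      by move=> e eD; apply: DT; rewrite inE eD orbT.
    by exists (t :: ts); rewrite /= tT td tsE.
  have -> : gamma = (\prod_(t <- ts) t)%g.
    by apply: rg_rep_inj; rewrite gammaE (rep_prod tsE).
  have tsl : size ts = l.
    by rewrite -(size_map (rg_rep W)) tsE size_map (simple_size hDelta hrank).
  by rewrite -[X in (_ <= X)%N]tsl lT_prod_le.
have [ts [/allP tsT tsE tsl]] := reduced_word gamma; rewrite -tsl.
have := gamma_unit; rewrite -tsE (rep_prod_roots (rt := rt)) => [|t /tsT/rtP[] //].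
move=> /sub_refl_prod_unit_span full; have := dim_span (map rt ts).
by rewrite full dimvf /dim /= mul1n size_map.
Qed.

Lemma gamma_triangular (rt : W -> 'rV[R]_l) ts :
  {in ts, forall t, rg_rep W t = refl_mx (rt t)} ->
  (\prod_(t <- ts) t)%g = gamma -> size ts = l ->
  pairwise (fun a b => wall_form (rg_rep W gamma) a b == 0) (map rt ts) /\
  <<map rt ts>>%VS = fullv.
Proof.
move=> rtP tsE tsl; have gE := rep_prod_roots rtP; rewrite tsE in gE.
have uG := gamma_unit; split; last by apply: sub_refl_prod_unit_span; rewrite -gE.
by apply: wall_form_triangular; rewrite ?size_map.
Qed.

Lemma gamma_wall_gt0 x : x != 0 -> 0 < wall_form (rg_rep W gamma) x x.
Proof.
move=> x0; rewrite wall_form_diag ?gamma_unit ?divr_gt0 ?dotv_gt0 //.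
exact: rg_orthogonal.
Qed.

End CoxeterElement.

(** * Covering relations and maximal chains *)

Section Covers.
Local Open Scope order_scope.
Context {d : Order.disp_t} (P : finTBPOrderType d).
Implicit Types (x y z u v : P) (s : seq P).

Lemma covers_lt x y : covers x y -> x < y.
Proof. by case/andP. Qed.

Lemma covers_eq x y z : covers x y -> x < z -> z <= y -> z = y.
Proof.
move=> /andP[_ /forallP/(_ z)]; rewrite negb_and => /orP[/negPf->//|zy _].
by rewrite le_eqVlt (negPf zy) orbF => /eqP.
Qed.

Lemma covers_intro x y : x < y -> (forall z, x < z -> z < y -> False) -> covers x y.
Proof.
move=> xy none; apply/andP; split=> //; apply/forallP => z; apply/negP.
by move=> /andP[]; apply: none.
Qed.

Lemma max_chain_nil u v : max_chain u v [::] = (u == v).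
Proof. by []. Qed.

Lemma max_chain_cons u v y s : max_chain u v (y :: s) = covers u y && max_chain y v s.
Proof. by rewrite /max_chain /= andbA. Qed.

End Covers.

(** * Covers and chains in the noncrossing partition poset *)

Section NoncrossingPartitions.
Local Open Scope group_scope.
Local Open Scope order_scope.
Context {R : realType} {l : nat} (W : reflection_group R l) (gamma : W).
Implicit Types (x y z u v : NC W gamma) (s : seq (NC W gamma)) (t w : W).

Definition elt x : W := val x.
Definition step x y : W := (elt x)^-1 * elt y.

Lemma elt_inj : injective elt.
Proof. exact: val_inj. Qed.

Lemma step_inj x : injective (step x).
Proof. by move=> y z /mulgI/elt_inj. Qed.

Lemma stepxx x : step x x = 1.
Proof. exact: mulVg. Qed.

Lemma stepM x y z : step x y * step y z = step x z.
Proof. by rewrite /step mulgA mulgK. Qed.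

Lemma NC_leE x y : (x <= y) = (lT (elt x) + lT (step x y) == lT (elt y))%N.
Proof. by []. Qed.

Lemma NC_le_lT x y : x <= y -> lT (elt y) = (lT (elt x) + lT (step x y))%N.
Proof. by rewrite NC_leE => /eqP. Qed.

Lemma NC_lt_lT x y : x < y -> (lT (elt x) < lT (elt y))%N.
Proof.
rewrite lt_neqAle => /andP[xy /NC_le_lT->]; rewrite -addn1 leq_add2l lt0n.
by apply: contraNN xy => /eqP/lT0; rewrite -(stepxx x) => /step_inj->.
Qed.

Lemma NC_elt w x : abs_le w (elt x) -> exists y, elt y = w.
Proof.
move=> wx; have xg : abs_le (elt x) gamma.
  by have := valP x; rewrite in_itv /= => /andP[].
have wP : (w : abs_poset W) \in `[1%g : abs_poset W, gamma].
  by rewrite in_itv /= abs_le1; apply: abs_le_trans xg.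
by exists (exist _ (w : abs_poset W) wP).
Qed.

Lemma step_refl_covers x y : x <= y -> step x y \in rg_refl W -> covers x y.
Proof.
move=> xy xyT; apply: covers_intro => [|z /NC_lt_lT xz /NC_lt_lT zy].
  rewrite lt_neqAle xy andbT; apply: contraTneq xyT => ->.
  by rewrite stepxx rg_refl_neq1.
have := NC_le_lT xy; move: xyT; rewrite -lT_eq1 => /eqP->.
lia.
Qed.

(** Subadditivity of [lT] along [x], [w], [z] bounds the lengths from the other side, so every
    inequality is an equality and [w] lies between [x] and [z]. *)
Lemma NC_between x z w : x <= z -> (elt x)^-1 * w \in rg_refl W ->
  ((lT (w^-1 * elt z)).+1 <= lT (step x z))%N ->
  exists y, [/\ elt y = w, covers x y & y <= z].
Proof.
move=> xz xwT wz; have xw1 := xwT; rewrite -lT_eq1 in xw1; move/eqP in xw1.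
have zE := NC_le_lT xz.
have w_le := lT_mul_le (elt x) w; have z_le := lT_mul_le w (elt z).
have [|y yE] := @NC_elt w z; first by rewrite /abs_le; lia.
have xy : x <= y by rewrite NC_leE /step yE; lia.
exists y; split=> //; last by rewrite NC_leE /step yE; lia.
by rewrite step_refl_covers // /step yE.
Qed.

(** Multiply [x] by the first letter of a reduced word of [step x z]. *)
Lemma ex_covers x z : x < z -> exists y, [/\ covers x y, y <= z & step x y \in rg_refl W].
Proof.
move=> xz; have [[|t ts] [tsT tsE tsl]] := reduced_word (step x z).
  have := NC_lt_lT xz; rewrite (NC_le_lT (ltW xz)) -tsl addn0; lia.
have/andP[tT tsT'] := tsT.
have [||y [yE xy yz]] := @NC_between x z (elt x * t) (ltW xz).
- by rewrite mulKg.
- have tz : t^-1 * step x z = \prod_(u <- ts) u by rewrite -tsE big_cons mulKg.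
  by rewrite invMg -mulgA tz -tsl ltnS lT_prod_le.
by exists y; rewrite /step yE mulKg.
Qed.

(** For a cover, the element that [ex_covers] places above [x] and below [y], one reflection away
    from [x], can only be [y]. *)
Lemma coversP x y : reflect (x <= y /\ step x y \in rg_refl W) (covers x y).
Proof.
apply: (iffP idP) => [xy|[]]; last exact: step_refl_covers.
have [z [xz zy zT]] := ex_covers (covers_lt xy).
have zE := covers_eq xy (covers_lt xz) zy.
by rewrite -zE ltW // covers_lt.
Qed.

(** A Hurwitz move: [t * t' = t' * t ^ t'], and the conjugate [t ^ t'] is again a reflection. *)
Lemma covers_swap x y z : covers x y -> covers y z ->
  exists y', [/\ covers x y', y' <= z & step x y' = step y z].
Proof.
move=> /coversP[xy xyT] /coversP[yz yzT].
have [||y' [y'E xy' y'z]] := @NC_between x z (elt x * step y z) (le_trans xy yz).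
- by rewrite mulKg.
- have -> : (elt x * step y z)^-1 * elt z = step x y ^ step y z.
    by rewrite conjgE stepM invMg mulgA.
  have := rg_refl_conj (step y z) xyT; rewrite -lT_eq1 => /eqP->.
  have := NC_le_lT xy; have := NC_le_lT yz; have := NC_le_lT (le_trans xy yz).
  by move: xyT yzT; rewrite -!lT_eq1 => /eqP-> /eqP->; lia.
by exists y'; rewrite /step y'E mulKg.
Qed.

Lemma max_chain_le u v s : max_chain u v s -> u <= v.
Proof.
elim: s u => [|x s IHs] u; first by rewrite max_chain_nil => /eqP->.
by rewrite max_chain_cons => /andP[/coversP[ux _] /IHs]; apply: le_trans.
Qed.

Lemma max_chain_word u v s (ts := pairmap step u s) : max_chain u v s ->
  [/\ all [in rg_refl W] ts, \prod_(t <- ts) t = step u v &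
      lT (elt v) = (lT (elt u) + size s)%N].
Proof.
rewrite {}/ts; elim: s u => [|x s IHs] u.
  by rewrite max_chain_nil => /eqP->; rewrite /= big_nil stepxx addn0.
rewrite max_chain_cons => /andP[/coversP[ux uxT] /IHs[sT sE ->]] /=.
rewrite uxT big_cons sE stepM; split=> //.
by rewrite (NC_le_lT ux) addnS; move: uxT; rewrite -lT_eq1 => /eqP->; rewrite addn1.
Qed.

Lemma NC_graded : graded (NC W gamma).
Proof.
move=> s s' /max_chain_word[_ _ sE] /max_chain_word[_ _ sE'].
by apply: (@addnI (lT (elt \bot))); rewrite -sE -sE'.
Qed.

End NoncrossingPartitions.

Arguments step {R l W gamma} x y.

(** * The edge labeling by ranks of positive roots *)

Section ELLabeling.
Local Open Scope ring_scope.
Context {R : realType} {l : nat} (W : reflection_group R l).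
Context (Phi Delta : seq 'rV[R]_l) (gamma : W).
Hypotheses (hPhi : root_system W Phi) (hDelta : simple_system Phi Delta).
Hypotheses (hrank : (\dim <<Phi>>)%VS = l) (gammaE : rg_rep W gamma = refl_prod Delta).
Context (rt : W -> 'rV[R]_l) (rk : 'rV[R]_l -> nat).
Hypothesis rtP : forall t, t \in rg_refl W ->
  [/\ rt t \in Phi, positive Delta (rt t) & rg_rep W t = refl_mx (rt t)].
Hypothesis rkP : forall a b, a \in Phi -> b \in Phi ->
  positive Delta a -> positive Delta b ->
  (rk a = rk b -> a = b) /\
  ((rk a < rk b)%N ->
    0 <= wall_form (rg_rep W gamma) a b /\ wall_form (rg_rep W gamma) b a <= 0).
Implicit Types (x y z u v : NC W gamma) (s : seq (NC W gamma)).
Notation chi := (wall_form (rg_rep W gamma)).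

Definition refl_rank (t : W) : nat := rk (rt t).
Definition NC_label u v : nat := refl_rank (step u v).

Lemma refl_rank_inj : {in rg_refl W &, injective refl_rank}.
Proof.
move=> t t' /rtP[tP tpos tE] /rtP[tP' tpos' tE'] eq_rk.
by apply: rg_rep_inj; rewrite tE tE' ((rkP _ _ _ _).1 eq_rk).
Qed.

Lemma refl_rank_wall t t' : t \in rg_refl W -> t' \in rg_refl W ->
  (refl_rank t < refl_rank t')%N -> 0 <= chi (rt t) (rt t') /\ chi (rt t') (rt t) <= 0.
Proof.
by move=> /rtP[tP tpos tE] /rtP[tP' tpos' tE'] /((rkP tP tP' tpos tpos').2).
Qed.

Lemma chain_labelE u s : chain_label NC_label u s = map refl_rank (pairmap step u s).
Proof. by elim: s u => //= x s IHs u; rewrite -IHs. Qed.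

(* Completing two chains of [[u, v]] by the same reduced words to factorizations
   of [gamma] shows that their roots span the same space. *)
Lemma chain_span u v s s' : max_chain u v s -> max_chain u v s' ->
  pairwise (fun a b => chi a b == 0) (map rt (pairmap step u s)) /\
  {subset map rt (pairmap step u s') <= <<map rt (pairmap step u s)>>%VS}.
Proof.
have rtE ts : all [in rg_refl W] ts -> {in ts, forall t, rg_rep W t = refl_mx (rt t)}.
  by move=> /allP tsT t /tsT/rtP[].
have [p [pT pE psz]] := reduced_word (elt u).
have [q [qT qE qsz]] := reduced_word ((elt v)^-1 * gamma)%g.
have triangular s0 : max_chain u v s0 ->
    let ts := p ++ pairmap step u s0 ++ q in
    [/\ pairwise (fun a b => chi a b == 0) (map rt ts), <<map rt ts>>%VS = fullv &
        0 \notin map rt ts].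
  move=> /max_chain_word[sT sE slen] ts.
  have tsT : all [in rg_refl W] ts by rewrite !all_cat pT sT qT.
  have vg : abs_le (elt v) gamma by have := valP v; rewrite in_itv /= => /andP[].
  (* The lengths of the three words add up to [l] because [elt v] lies below [gamma]. *)
  have [] := gamma_triangular hDelta hrank gammaE (rtE _ tsT).
  - by rewrite !big_cat /= pE sE qE /step -mulgA !mulVKg.
  - rewrite /ts !size_cat psz qsz size_pairmap addnA -slen.
    by rewrite (eqP vg) (lT_gamma hPhi hDelta hrank gammaE).
  split=> //; apply/negP => /mapP[t /(allP tsT)/rtP[/(rs_neq0 hPhi)/eqP t0 _ _]].
  by move=> /esym/t0.
move=> /triangular[]; rewrite !map_cat => tri full ts0.
move=> /triangular[]; rewrite !map_cat => tri' _ _; split.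
  by move: tri; rewrite !pairwise_cat => /and3P[_ _ /and3P[]].
move=> a as'; have wall_gt0 := gamma_wall_gt0 hDelta hrank gammaE.
(* In the factorization through [s'], the root [a] stands between those of [p] and those of [q];
   this gives the vanishing pairings needed to locate it in the factorization through [s]. *)
apply: (triangular_span wall_gt0 ts0 tri) => [|b bp|b bq].
- by rewrite full memvf.
- move: tri'; rewrite pairwise_cat => /andP[/allrelP pP _].
  by apply/eqP/pP => //; rewrite mem_cat as'.
- move: tri'; rewrite !pairwise_cat => /and3P[_ _ /andP[/allrelP sP _]].
  by apply/eqP/sP.
Qed.

Lemma rising_first_label u v y s s' :
  max_chain u v (y :: s) -> max_chain u v s' -> rising NC_label u s' ->
  ~~ all (fun k => NC_label u y < k)%N (chain_label NC_label u s').
Proof.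
move=> ys s'c; rewrite /rising chain_labelE => s'r; apply/negP => /allP y_min.
have [tri /(_ (rt (step u y)))] := chain_span s'c ys.
rewrite mem_head => /(_ isT) y_span.
have [/andP[yT _] _ _] := max_chain_word ys.
have [/allP sT _ _] := max_chain_word s'c.
have y_wall t : t \in pairmap step u s' ->
    0 <= chi (rt (step u y)) (rt t) /\ chi (rt t) (rt (step u y)) <= 0.
  by move=> ts; apply: refl_rank_wall (sT _ ts) _ => //; apply: y_min; apply: map_f.
have wall_gt0 := gamma_wall_gt0 hDelta hrank gammaE.
have [yP ypos _] := rtP yT; have y0 := rs_neq0 hPhi yP.
have := wall_gt0 _ y0; rewrite ltNge => /negP; apply.
(* Both vectors of the cone lemma are taken to be the root of [step u y]. *)
apply: (triangular_cone_le0 wall_gt0 _ _ y_span).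
- apply/negP => /mapP[t /sT/rtP[/(rs_neq0 hPhi)/eqP t0 _ _]].
  by move=> /esym/t0.
(* Rising labels are pairwise increasing, so the root order adds the sign condition to the vanishing
   given by [tri]. *)
- move: tri s'r; rewrite (sorted_pairwise lt_trans) !pairwise_map => tri s'r.
  have := conj tri s'r => /andP; rewrite -pairwise_relI.
  apply: (sub_in_pairwise (P := [in rg_refl W])) => [t t' tT t'T /= /andP[-> ltt]|].
    by case: (refl_rank_wall tT t'T ltt).
  exact/allP.
- by move=> _ /mapP[t /y_wall[? _] ->].
- by move=> _ /mapP[t /y_wall[_ ?] ->].
Qed.

Lemma rising_unique u v s s' : max_chain u v s -> rising NC_label u s ->
  max_chain u v s' -> rising NC_label u s' -> s' = s.
Proof.
elim: s u s' => [|y s IHs] u [|y' s'] sc sr s'c s'r //.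
- by have [[_ _ ->] [_ _]] := (max_chain_word sc, max_chain_word s'c) => /addnI.
- by have [[_ _ ->] [_ _]] := (max_chain_word sc, max_chain_word s'c) => /addnI.
(* The first label of a rising chain is its least one, so if it exceeded the label of [z], all the
   others would too, against [rising_first_label]. *)
have first_le r z z' r' : max_chain u v (z :: r) -> max_chain u v (z' :: r') ->
    rising NC_label u (z' :: r') -> (NC_label u z' <= NC_label u z)%N.
  move=> zc zc' zr'; have := rising_first_label zc zc' zr'.
  rewrite leqNgt; apply: contraNN => lt_z; rewrite /= lt_z.
  move: zr'; rewrite /rising /= (path_sortedE lt_trans) => /andP[/allP min_z' _].
  by apply/allP => k /min_z'; apply: ltn_trans.
have yy' : y = y'.
  have eq_l : NC_label u y = NC_label u y'.
    by apply/eqP; rewrite eqn_leq (first_le _ _ _ _ s'c sc) // (first_le _ _ _ _ sc s'c).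
  move: sc s'c; rewrite !max_chain_cons.
  move=> /andP[/coversP[_ yT] _] /andP[/coversP[_ yT'] _].
  exact: step_inj (refl_rank_inj yT yT' eq_l).
rewrite -{}yy' in s'c s'r *; congr (_ :: _); apply: (IHs y).
- by move: sc; rewrite max_chain_cons => /andP[].
- exact: path_sorted sr.
- by move: s'c; rewrite max_chain_cons => /andP[].
- exact: path_sorted s'r.
Qed.

Lemma rising_least u v : (u <= v)%O -> exists s,
  [/\ max_chain u v s, rising NC_label u s & forall s', max_chain u v s' ->
      (chain_label NC_label u s <= chain_label NC_label u s' :> seqlexi nat)%O].
Proof.
have [n] := ubnP (lT (elt v) - lT (elt u))%N; elim: n u => // n IHn u le_n uv.
have [uv_eq|uNv] := eqVneq u v.
  exists [::]; split=> //; first by rewrite /max_chain /= uv_eq.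
have ltuv : (u < v)%O by rewrite lt_neqAle uNv.
have [y0 [uy0 y0v _]] := ex_covers ltuv.
pose P y := covers u y && (y <= v)%O.
have Py0 : P y0 by rewrite /P uy0.
case: (arg_minnP (NC_label u) Py0) => y /andP[uy yv] y_min.
have [_ uyT] := coversP _ _ uy; have lt_uy := covers_lt uy.
have [|s [sc sr s_min]] := IHn y _ yv.
  exact: leq_trans (ltn_sub2l (NC_lt_lT ltuv) (NC_lt_lT lt_uy)) le_n.
exists (y :: s); split.
- by rewrite max_chain_cons uy.
- case: s sc sr {s_min} => //= z s; rewrite max_chain_cons => /andP[yz sc] sr.
  apply/andP; split=> //.
  (* The swap makes the second label available at [u], so greediness excludes a descent. *)
  have [y' [uy' y'z y'E]] := covers_swap uy yz.
  have zv := max_chain_le sc.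
  have le_yz : (NC_label u y <= NC_label y z)%N.
    by rewrite /NC_label -y'E; apply: y_min; rewrite /P uy' (le_trans y'z).
  (* Equal labels would repeat a reflection, making [step u z] trivial although [u < z]. *)
  rewrite ltEnat /= ltn_neqAle le_yz andbT; apply/eqP => eq_l.
  have /coversP[_ yzT] := yz.
  have stepE := refl_rank_inj uyT yzT eq_l.
  have lt_yz := covers_lt yz; have := lt_trans lt_uy lt_yz; rewrite lt_neqAle.
  by rewrite -(inj_eq (@step_inj _ _ _ _ u)) stepxx -(stepM u y z) stepE rg_refl_sq ?eqxx.
move=> [|y' s']; first by rewrite max_chain_nil (negPf uNv).
rewrite max_chain_cons => /andP[uy' s'c]; have y'v := max_chain_le s'c.
have le_l : (NC_label u y <= NC_label u y')%N by apply: y_min; rewrite /P uy'.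
rewrite /= lexi_cons leEnat le_l /=; apply/implyP => ge_l.
(* A tie in the first label forces the same vertex, which leaves the comparison to the chains above
   [y]. *)
have yy' : y = y'.
  have /coversP[_ yT'] := uy'.
  by apply: step_inj (refl_rank_inj uyT yT' _); apply/eqP; rewrite eqn_leq le_l.
by rewrite -yy' in s'c *; apply: s_min.
Qed.

End ELLabeling.

Theorem theorem1p1 (R : realType) (l : nat) (W : reflection_group R l)
    (Phi : seq 'rV[R]_l) (hPhi : root_system W Phi)
    (hrank : (\dim <<Phi>>)%VS = l)
    (gamma : W) (hgamma : coxeter_element Phi gamma) :
  EL_shellable (NC W gamma).
Proof.
have [Delta [ts [hDelta tsE gammaE]]] := hgamma.
have repE : rg_rep W gamma = refl_prod Delta by rewrite gammaE (rep_prod tsE).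
have [rt rtP] := positive_root hPhi hDelta.
have [rk rkP] := root_order hPhi hDelta hrank repE.
split; first exact: NC_graded.
exists Order.NatOrder.nat_display, nat, (NC_label rt rk) => u v uv.
have [s [sc sr s_min]] := rising_least rtP rkP (ltW uv).
exists s; split=> // s' s'c s'r.
exact: (rising_unique hPhi hDelta hrank repE rtP rkP sc sr).
Qed.
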